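(* Let $k \geq 1$ be an integer and let $G$ be a connected $n$-vertex graph such that $(G,k)$ is not special. Let $\mathcal{F} = \mathcal{F}_{0,k} \cup \mathcal{F}_{1,k}$. Then \[\iota(G,\mathcal{F}) \leq \left\lfloor \frac{n}{k+1} \right\rfloor.\] Moreover, equality holds if $G = B_{n,k}$.
   Context: All graphs are finite and simple. For a vertex $v$, $N[v]$ is its closed neighbourhood, and for $D \subseteq V(G)$, $N[D] = \bigcup_{v \in D} N[v]$. Given a set $\mathcal{F}$ of graphs, an $\mathcal{F}$-graph is a graph isomorphic to a member of $\mathcal{F}$. A set $D \subseteq V(G)$ is $\mathcal{F}$-isolating if $G - N[D]$ contains no $\mathcal{F}$-graph as a subgraph, and $\iota(G,\mathcal{F})$ is the minimum size of an $\mathcal{F}$-isolating set of $G$. $K_{1,k}$ denotes the star with $k$ leaves. $\mathcal{F}_{0,k} = \{K_{1,k}\}$, and $\mathcal{F}_{1,k}$ is the set of all regular graphs whose degree is at least $k-1$. The pair $(G,k)$ is called special if either $G$ is a $k$-clique (a copy of $K_k$), or $k = 2$ and $G$ is a $5$-cycle. The graph $B_{n,k}$ ($n,k \geq 1$) is defined as follows: let $q = \lfloor n/(k+1) \rfloor$ and $n = q(k+1) + r$ with $0 \leq r \leq k$. If $q = 0$, $B_{n,k} = K_r$. If $q \geq 1$, take pairwise vertex-disjoint cliques $B_1, \dots, B_q$ on $k+1$ vertices each and $B_{q+1}$ on $r$ vertices; let $q' = q$ if $r = 0$ and $q' = q+1$ if $r \geq 1$; choose $b_i \in V(B_i)$ for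 $i \in [q']$; then $B_{n,k}$ has vertex set $\bigcup_{i=1}^{q'} V(B_i)$ and edge set $\{b_ib_{i+1} : i \in [q'-1]\} \cup \bigcup_{i=1}^{q'} E(B_i)$. *)

(* Defs.v *)
(* Simple graphs = symmetric irreflexive relations on a finType. *)
From mathcomp Require Import all_boot.
From mathcomp Require Import boolp.
Set Implicit Arguments. Unset Strict Implicit. Unset Printing Implicit Defensive.

Section Graphs.
Variable T : finType.

Definition closed_nbhd (g : rel T) (D : {set T}) : {set T} :=
  [set v | [exists u in D, (u == v) || g u v]].

Definition subgraph_in (T' : finType) (h : rel T') (g : rel T) (R : {set T}) :=
  exists f : T' -> T, [/\ injective f, (forall x, f x \in R) &
                         (forall x y, h x y -> g (f x) (f y))].

Definition isomorphic (T' : finType) (h : rel T') (g : rel T) :=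
  exists f : T' -> T, bijective f /\ (forall x y, g (f x) (f y) = h x y).
End Graphs.

(* A family of graphs, given up to isomorphism as a predicate on graphs on 'I_m *)
Definition graph_family := forall m : nat, rel 'I_m -> Prop.

Definition isolating (T : finType) (g : rel T) (F : graph_family) (D : {set T}) :=
  forall m (h : rel 'I_m), F m h -> ~ subgraph_in h g (~: closed_nbhd g D).

(* iota(G,F): minimum size of an F-isolating set (default #|T| if none exists) *)
Definition iso_number (T : finType) (g : rel T) (F : graph_family) : nat :=
  \big[minn/#|T|]_(D : {set T} | `[< isolating g F D >]) #|D|.

Definition complete_graph (k : nat) : rel 'I_k := fun x y => x != y.
Definition star (k : nat) : rel 'I_k.+1 :=
  fun x y => (x == ord0) != (y == ord0).
Definition cycle5 : rel 'I_5 :=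
  fun x y => (y == (x.+1 %% 5) :> nat) || (x == (y.+1 %% 5) :> nat).

Definition regular_graph (m : nat) (h : rel 'I_m) (r : nat) :=
  [/\ 0 < m, symmetric h, irreflexive h & forall x, #|[set y | h x y]| = r].

Definition Fk (k : nat) : graph_family := fun m h =>
  isomorphic (@star k) h \/ exists r, k.-1 <= r /\ regular_graph h r.

Definition special (T : finType) (g : rel T) (k : nat) :=
  isomorphic (@complete_graph k) g \/ (k = 2 /\ isomorphic cycle5 g).

(* B_{n,k}: vertex i lies in block i %/ (k+1); b_j is the first vertex j*(k+1)
   of block j; blocks are cliques, consecutive b_j's are adjacent. *)
Definition Bnk (n k : nat) : rel 'I_n := fun x y =>
  ((x %/ k.+1 == y %/ k.+1) && (x != y))
  || [&& (x %% k.+1 == 0), (y %% k.+1 == 0) &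
         (((x %/ k.+1).+1 == y %/ k.+1) || ((y %/ k.+1).+1 == x %/ k.+1))].
Arguments Bnk : clear implicits.

(* Main.v *)
(* Induct on the vertex sets V inducing connected subgraphs, building D with
   (k+1)|D| <= |V|; call V special if it induces K_k, or C_5 when k = 2. If
   deleting a vertex x leaves a special component, put x in D: each special
   component, having lost a neighbour of x, then needs one vertex fewer.
   Otherwise take v of maximum degree. If no component of V - N[v] is special,
   put v in D. If one, H, is special, it has a neighbour x in N(v), and H + x can
   be dominated within the budget; the remaining components are bounded by
   induction unless the component A of v is special. Since H has a second
   neighbour x' in N(v), which lies in A, explicit choices near v, x, x' settle
   that case; they fail only if V itself induces a C_5. *)
Require Import Defs.
From mathcomp Require Import all_boot.
From mathcomp Require Import boolp zify.
Set Implicit Arguments. Unset Strict Implicit. Unset Printing Implicit Defensive.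

Section Isolation.
Variables (T : finType) (g : rel T) (k : nat).
Hypotheses (gS : symmetric g) (gI : irreflexive g) (k_gt0 : 0 < k).
Implicit Types (A B C D H R S U V W X : {set T}) (u v w x y z : T).

Local Notation "N[ D ]" := (closed_nbhd g D).

(** * Closed neighbourhoods, degrees inside a set, and sets free of forbidden subgraphs *)

Lemma nbhdP D v : reflect (exists2 u, u \in D & (u == v) || g u v) (v \in N[D]).
Proof. by rewrite inE; apply: exists_inP. Qed.

Lemma nbhdS D1 D2 : D1 \subset D2 -> N[D1] \subset N[D2].
Proof.
move=> /subsetP sD; apply/subsetP=> v /nbhdP[u uD uv].
by apply/nbhdP; exists u => //; apply: sD.
Qed.

Lemma mem_nbhd D u v : u \in D -> (u == v) || g u v -> v \in N[D].
Proof. by move=> uD uv; apply/nbhdP; exists u. Qed.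

Lemma nbhd1 u v : (v \in N[[set u]]) = (u == v) || g u v.
Proof.
by apply/nbhdP/idP=> [[w /set1P->]|uv] //; exists u; rewrite ?set11.
Qed.

Lemma adj_neq x y : g x y -> x != y.
Proof. by apply: contraTneq => ->; rewrite gI. Qed.

Definition nb S v : {set T} := [set u in S | g v u].

Lemma nbS S R v : S \subset R -> #|nb S v| <= #|nb R v|.
Proof.
move=> sSR; apply/subset_leq_card/subsetP=> u; rewrite !inE => /andP[uS ->].
by rewrite (subsetP sSR).
Qed.

Lemma nb_lt S v : v \in S -> #|nb S v| < #|S|.
Proof.
move=> vS; rewrite (cardsD1 v S) vS ltnS.
apply/subset_leq_card/subsetP=> u; rewrite !inE => /andP[-> /adj_neq].
by rewrite eq_sym => ->.
Qed.

Definition sep A B := forall a b, a \in A -> b \in B -> ~~ g a b.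

Lemma sepC A B : sep A B -> sep B A.
Proof. by move=> sAB a b aB bA; rewrite gS; apply: sAB. Qed.

Lemma sepS A B A' B' : A' \subset A -> B' \subset B -> sep A B -> sep A' B'.
Proof.
move=> /subsetP sA /subsetP sB sAB a b /sA aA /sB bB; exact: sAB.
Qed.

(* For a graph of maximum degree below [k], containing a regular subgraph of
   degree at least [k - 1] means having a nonempty set of vertices inducing a
   subgraph of minimum degree at least [k - 1]. *)
Definition good R :=
  (forall v, v \in R -> #|nb R v| < k) /\
  (forall S, S \subset R -> S != set0 -> exists2 v, v \in S & #|nb S v| < k.-1).

Lemma good_sub R1 R2 : R1 \subset R2 -> good R2 -> good R1.
Proof.
move=> sR [dR mR]; split=> [v vR1|S sS].
  by apply: leq_ltn_trans (nbS _ sR) _; apply: dR; apply: (subsetP sR).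
by apply: mR; apply: subset_trans sS sR.
Qed.

Lemma good_small R : #|R| < k -> good R.
Proof.
move=> Rk; split=> [v vR|S sS /set0Pn[v vS]].
  by apply: ltn_trans (nb_lt vR) Rk.
exists v => //; have := nb_lt vS; have := subset_leq_card sS; lia.
Qed.

(** No vertex gains a neighbour across a separation. A set [S] that meets [R1] takes its vertex of
    low degree from [S :&: R1]; otherwise [S] lies in [R2]. *)
Lemma good_sepU R1 R2 : sep R1 R2 -> good R1 -> good R2 -> good (R1 :|: R2).
Proof.
move=> sR [d1 m1] [d2 m2].
have nbE S v A B : sep A B -> v \in A -> S \subset A :|: B ->
    nb S v \subset nb (S :&: A) v.
  move=> sAB vA sS; apply/subsetP=> u; rewrite !inE => /andP[uS vu].
  rewrite uS vu !andbT; have := subsetP sS _ uS; rewrite inE => /orP[//|uB].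
  by have := sAB _ _ vA uB; rewrite vu.
have R2R1 : R1 :|: R2 \subset R2 :|: R1 by rewrite setUC.
split=> [v|S sS Sn0].
  rewrite inE => /orP[vR|vR].
    apply: leq_ltn_trans (d1 _ vR).
    apply: leq_trans (subset_leq_card (nbE _ _ _ _ sR vR (subxx _))) _.
    by apply: nbS; apply: subsetIr.
  apply: leq_ltn_trans (d2 _ vR).
  apply: leq_trans (subset_leq_card (nbE _ _ _ _ (sepC sR) vR R2R1)) _.
  by apply: nbS; apply: subsetIr.
have [SR0|SR] := eqVneq (S :&: R1) set0.
  apply: m2 => //; apply/subsetP=> u uS; have := subsetP sS _ uS.
  rewrite inE => /orP[uR|//]; have : u \in S :&: R1 by rewrite inE uS.
  by rewrite SR0 inE.
have [v vS vd] := m1 _ (subsetIr S R1) SR.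
move: (vS); rewrite inE => /andP[vS' vR].
exists v => //; apply: leq_ltn_trans vd.
exact: subset_leq_card (nbE _ _ _ _ sR vR sS).
Qed.

(** * Connectivity in cut form, components, and isolation within a budget *)

Definition connset V := forall S,
  S \subset V -> S != set0 -> S != V ->
  exists a b, [/\ a \in S, b \in V :\: S & g a b].

Definition component C W :=
  [/\ C \subset W, C != set0, sep C (W :\: C) & connset C].

(** Take [C] minimal among the subsets of [W] that contain [v] and send no edge to the rest of [W].
    If a part [S] of [C] sent no edge to [C :\: S], whichever of the two contains [v] would be a
    smaller such set. *)
Lemma component_of W v : v \in W -> exists2 C, component C W & v \in C.
Proof.
move=> vW; pose P C := [&& v \in C, C \subset W &
  [forall a in C, forall b in W :\: C, ~~ g a b]].
have PP C : reflect [/\ v \in C, C \subset W & sep C (W :\: C)] (P C).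
  apply: (iffP and3P)=> -[vC sC sp]; split=> //.
    by move=> a b aC bC; have /forall_inP/(_ _ aC)/forall_inP := sp; apply.
  by apply/forall_inP=> a aC; apply/forall_inP=> b bC; apply: sp.
have PW : P W by apply/PP; split=> // a b; rewrite setDv inE.
have [C /minsetP[/PP[vC sCW sepCW] minC] _] := minset_exists PW.
exists C => //; split=> //; first by apply/set0Pn; exists v.
move=> S sS Sn0 SnC.
have [//|nex] := EM (exists a b, [/\ a \in S, b \in C :\: S & g a b]).
have sp a b : a \in S -> b \in C -> b \notin S -> ~~ g a b.
  move=> aS bC bS; apply/negP=> ab; apply: nex.
  by exists a, b; split=> //; rewrite inE bS.
have := SnC; have [vS|vS] := boolP (v \in S).
  rewrite (minC S) ?eqxx //; apply/PP; split=> //.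
    exact: subset_trans sS sCW.
  move=> a b aS; rewrite inE => /andP[bS bW].
  have [bC|bC] := boolP (b \in C); first exact: sp.
  by apply: sepCW; rewrite ?inE ?bC // (subsetP sS).
move: Sn0 => /set0Pn[z zS].
suff E : C :\: S = C by have := subsetP sS _ zS; rewrite -E inE zS.
apply: minC (subsetDl _ _); apply/PP; split; rewrite ?inE ?vS //.
  exact: subset_trans (subsetDl _ _) sCW.
move=> a b; rewrite !inE => /andP[aS aC]; rewrite negb_and negbK.
move=> /andP[/orP[bS|bC] bW]; first by rewrite gS; apply: sp.
by apply: sepCW; rewrite ?inE ?bC.
Qed.

Lemma component_trans C W V : component C W -> W \subset V ->
  sep W (V :\: W) -> component C V.
Proof.
move=> [sC C0 sp cC] sWV sp'; split=> //.
  exact: subset_trans sC sWV.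
move=> a b aC; rewrite inE => /andP[bC bV].
have [bW|bW] := boolP (b \in W); first by apply: sp; rewrite ?inE ?bC.
by apply: sp'; rewrite ?inE ?bW // (subsetP sC).
Qed.

Lemma component_closed C W a b :
  component C W -> a \in C -> b \in W -> g a b -> b \in C.
Proof.
move=> [_ _ sp _] aC bW; apply: contraLR => bC.
by apply: sp; rewrite ?inE ?bC.
Qed.

(** The vertices of [B] are paid for elsewhere and act for free; only [D] is charged to [W], at
    [k + 1] vertices of [W] for each vertex of [D]. *)
Definition bounded B W :=
  exists2 D : {set T}, #|D| * k.+1 <= #|W| & good (W :\: N[B :|: D]).

Lemma bounded_sepU B W1 W2 : [disjoint W1 & W2] -> sep W1 W2 ->
  bounded B W1 -> bounded B W2 -> bounded B (W1 :|: W2).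
Proof.
move=> dW sW [D1 c1 g1] [D2 c2 g2]; exists (D1 :|: D2).
  have [_] := leq_card_setU W1 W2; rewrite dW => /eqP ->.
  apply: leq_trans (leq_add c1 c2); rewrite -mulnDl leq_mul2r.
  by rewrite leq_card_setU orbT.
have := good_sepU _ g1 g2; set Q := (X in good X) => HQ.
apply: (@good_sub _ Q); last first.
  by apply: HQ; apply: sepS sW; apply: subsetDl.
rewrite /Q setDUl; apply: setUSS; apply: setDS; apply: nbhdS; apply: setUS.
  exact: subsetUl.
exact: subsetUr.
Qed.

Lemma bounded_components B W :
  (forall C, component C W -> bounded B C) -> bounded B W.
Proof.
have [n] := ubnP #|W|; elim: n W => // n IH W Wn HW.
have [->|[v vW]] := set_0Vmem W.
  by exists set0; rewrite ?cards0 // set0D; apply: good_small; rewrite cards0.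
have [C cC vC] := component_of vW; have [sC C0 sp _] := cC.
have -> : W = C :|: W :\: C.
  by rewrite -{1}(setID W C); congr (_ :|: _); apply/setIidPr.
apply: bounded_sepU => //; first by rewrite disjoints_subset setCD subsetUr.
  exact: HW.
apply: IH => [|C' cC'].
  have := cardsID C W; rewrite (setIidPr sC).
  by move: C0; rewrite -card_gt0; lia.
apply: HW; apply: component_trans cC' (subsetDl _ _) _.
rewrite setDDr setDv set0U; apply: sepC; apply: sepS sp => //.
exact: subsetIr.
Qed.

(** The leftover of [X] has no edge to [V :\: X], so it cannot combine with the leftover there into
    a forbidden subgraph, and the two budgets add up. *)
Lemma bounded_extend X V D : X \subset V -> #|D| * k.+1 <= #|X| ->
  good (X :\: N[D]) -> sep (X :\: N[D]) (V :\: X) -> bounded set0 (V :\: X) ->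
  bounded set0 V.
Proof.
move=> sX cD gX sXV [D' cD' gD']; exists (D :|: D').
  rewrite -(cardsID X V) (setIidPr sX).
  apply: leq_trans (leq_add cD cD'); rewrite -mulnDl leq_mul2r.
  by rewrite leq_card_setU orbT.
rewrite set0U in gD' *.
have := good_sepU _ gX gD'; set Q := (X in good X) => HQ.
apply: (@good_sub _ Q); last first.
  by apply: HQ; apply: sepS sXV => //; apply: subsetDl.
have N1 := nbhdS (subsetUl D D'); have N2 := nbhdS (subsetUr D D').
apply/subsetP=> z; rewrite set0U in_setD => /andP[zN zV].
rewrite /Q in_setU !in_setD zV (contra (subsetP N1 z) zN).
by rewrite (contra (subsetP N2 z) zN) /= andbT orbN.
Qed.

(** * Induced 5-cycles and special sets *)

Definition c5 a b c d e := [&& uniq [:: a; b; c; d; e],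
  g a b, g b c, g c d, g d e, g e a,
  ~~ g a c, ~~ g a d, ~~ g b d, ~~ g b e & ~~ g c e].

Lemma c5_rot a b c d e : c5 a b c d e -> c5 b c d e a.
Proof.
rewrite /c5 => /and5P[uq -> -> -> /and5P[-> -> ac ad /and3P[-> -> ->]]].
rewrite -(rot_uniq 1) in uq.
by rewrite uq /= ![g _ a]gS ac ad.
Qed.

Lemma c5_rev a b c d e : c5 a b c d e -> c5 a e d c b.
Proof.
rewrite /c5 => /and5P[uq ab bc cd /and5P[de ea ac ad /and3P[bd be ce]]].
rewrite -rev_uniq -(rot_uniq 4) in uq.
rewrite uq /= (gS a e) (gS e d) (gS d c) (gS c b) (gS b a).
rewrite (gS e c) (gS e b) (gS d b).
by rewrite ea de cd bc ab ac ad bd be ce.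
Qed.

Definition is_c5 C := exists a b c d e, c5 a b c d e /\ C =i [:: a; b; c; d; e].

Lemma is_c5_at C v : is_c5 C -> v \in C ->
  exists b c d e, c5 v b c d e /\ C =i [:: v; b; c; d; e].
Proof.
move=> [a [b [c [d [e [h1 E]]]]]]; rewrite E.
have h2 := c5_rot h1; have h3 := c5_rot h2; have h4 := c5_rot h3.
have h5 := c5_rot h4.
have E2 : C =i [:: b; c; d; e; a] by move=> z; rewrite E -(mem_rot 1).
have E3 : C =i [:: c; d; e; a; b] by move=> z; rewrite E2 -(mem_rot 1).
have E4 : C =i [:: d; e; a; b; c] by move=> z; rewrite E3 -(mem_rot 1).
have E5 : C =i [:: e; a; b; c; d] by move=> z; rewrite E4 -(mem_rot 1).
rewrite !inE => /or4P[/eqP->|/eqP->|/eqP->|/orP[/eqP->|/eqP->]].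
- by exists b, c, d, e.
- by exists c, d, e, a.
- by exists d, e, a, b.
- by exists e, a, b, c.
- by exists a, b, c, d.
Qed.

Lemma c5_card C a b c d e : c5 a b c d e -> C =i [:: a; b; c; d; e] -> #|C| = 5.
Proof. by move=> /and5P[uq _ _ _ _] E; rewrite (eq_card E) (card_uniqP uq). Qed.

Definition clique C := forall x y, x \in C -> y \in C -> x != y -> g x y.

Definition spec C := (clique C /\ #|C| = k) \/ (k = 2 /\ is_c5 C).

(** Once [y] is dominated from outside, [H] saves [k] of its budget. A [K_k] without [y] is too
    small to matter; on a 5-cycle, the vertex [c] at distance two from [y] leaves only [e]. *)
Lemma spec_kill H y : spec H -> y \in H ->
  exists2 D : {set T}, #|D| * k.+1 + k <= #|H| & good (H :\ y :\: N[D]).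
Proof.
move=> [[_ cH]|[k2 c5H]] yH.
  exists set0; rewrite ?cards0 ?cH //; apply: good_small.
  have := subset_leq_card (subsetDl (H :\ y) N[set0]).
  by have := cardsD1 y H; rewrite yH cH; lia.
have [b [c [d [e [h E]]]]] := is_c5_at c5H yH.
exists [set c]; first by rewrite cards1 (c5_card h E) k2.
apply: good_small; rewrite k2 ltnS -(cards1 e).
move: h => /and5P[_ ab bc cd _].
apply/subset_leq_card/subsetP=> z; rewrite in_setD in_setD1 nbhd1 E !inE => /and3P[zN zy].
case/or4P=> [|||/orP[]] /eqP zE //; move: zN zy; rewrite zE ?eqxx //.
  by rewrite (gS c) bc orbT.
by rewrite cd orbT.
Qed.

(** One vertex beyond [H] completes the budget: [k + 1] pays for [y] on a clique, and 6 pays for [y]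
    and a vertex at distance two on a 5-cycle. Having [y] in [D] lets [D] also dominate an outside
    neighbour of [y]. *)
Lemma spec_cover H y : spec H -> y \in H ->
  exists D : {set T}, [/\ y \in D, H \subset N[D] & #|D| * k.+1 <= #|H|.+1].
Proof.
move=> [[kH cH]|[k2 c5H]] yH.
  exists [set y]; rewrite set11 cards1 cH mul1n; split=> //.
  apply/subsetP=> z zH; rewrite nbhd1; case: eqVneq => //= yz.
  exact: kH.
have [b [c [d [e [h E]]]]] := is_c5_at c5H yH.
exists [set y; c]; rewrite !inE eqxx (c5_card h E) k2; split=> //; last first.
  by rewrite cards2; case: (_ != _).
move: h => /and5P[_ ab bc cd /and3P[de ea _]].
apply/subsetP=> z; rewrite E => zE; apply/nbhdP; move: zE; rewrite !inE.
case/or4P => [|||/orP[]] /eqP->.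
- by exists y; rewrite ?inE ?eqxx.
- by exists y; rewrite ?inE ?eqxx // ab orbT.
- by exists c; rewrite ?inE ?eqxx ?orbT.
- by exists c; rewrite ?inE ?eqxx ?cd ?orbT.
- by exists y; rewrite ?inE ?eqxx // gS ea orbT.
Qed.


Lemma bounded_mono B1 B2 W : B1 \subset B2 -> bounded B1 W -> bounded B2 W.
Proof.
move=> sB [D cD gD]; exists D => //.
by apply: good_sub gD; apply: setDS; apply: nbhdS; apply: setSU.
Qed.

Lemma bounded_cover X V D : X \subset V -> #|D| * k.+1 <= #|X| ->
  X \subset N[D] -> bounded set0 (V :\: X) -> bounded set0 V.
Proof.
move=> sX cD; rewrite -setD_eq0 => /eqP XD.
apply: bounded_extend sX cD _ _; rewrite XD.
  by apply: good_small; rewrite cards0.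
by move=> a b; rewrite inE.
Qed.

(** * The induction step: deleting one vertex *)

Section InductionStep.
Variable V : {set T}.
Hypothesis IH : forall W, #|W| < #|V| -> connset W -> ~ spec W -> bounded set0 W.
Hypothesis conV : connset V.

Lemma bounded_no_spec W : #|W| < #|V| ->
  (forall C, component C W -> ~ spec C) -> bounded set0 W.
Proof.
move=> WV nsp; apply: bounded_components => C cC; have [sC _ _ conC] := cC.
apply: IH => //; last exact: nsp.
exact: leq_ltn_trans (subset_leq_card sC) WV.
Qed.

(* Put [x] in the isolating set: it weakens every special component of [V - x],
   which then needs one vertex fewer, and the special component [C] pays for
   [x]. *)
Lemma bounded_cut x C :
  x \in V -> component C (V :\ x) -> spec C -> bounded set0 V.
Proof.
move=> xV cC spC.
(* Connectivity of [V] forces an edge out of [C'], and it can only end in [x]. *)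
have link C' : component C' (V :\ x) -> exists2 y, y \in C' & g x y.
  move=> cC'; have [sC' C0 _ _] := cC'.
  have [||a [b [aC bC ab]]] := conV _ C0.
  - exact: subset_trans sC' (subsetDl _ _).
  - by apply: contraTneq sC' => ->; rewrite subsetD1 xV andbF.
  exists a => //; move: bC; rewrite inE => /andP[bC bV].
  have [<-|bx] := eqVneq b x; first by rewrite gS.
  by rewrite (component_closed cC' aC _ ab) ?inE ?bx in bC.
have kill C' : component C' (V :\ x) -> spec C' -> exists2 D : {set T},
    #|D| * k.+1 + k <= #|C'| & good (C' :\: N[[set x] :|: D]).
  move=> cC' spC'; have [y yC xy] := link _ cC'.
  have [D cD gD] := spec_kill spC' yC; exists D => //.
  apply: good_sub gD; apply/subsetP=> z; rewrite !in_setD in_set1 => /andP[zN zC].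
  rewrite zC andbT (contra (subsetP (nbhdS (subsetUr _ _)) z) zN).
  apply: contraNneq zN => ->; apply: (@mem_nbhd _ x).
    by rewrite !inE eqxx.
  by rewrite xy orbT.
have [sC C0 spCV _] := cC.
have [D cD gD] := kill _ cC spC.
(* Here [x] is free: its price [k + 1] is met by [x] itself and the [k] saved in [C]. *)
have [D' cD' gD'] : bounded [set x] (V :\ x :\: C).
  apply: bounded_components => C' cC'.
  have {}cC' : component C' (V :\ x).
    apply: component_trans cC' (subsetDl _ _) _.
    rewrite setDDr setDv set0U; apply: sepC; apply: sepS spCV => //.
    exact: subsetIr.
  have [spC'|nsp] := EM (spec C').
    by have [D1 cD1 gD1] := kill _ cC' spC'; exists D1 => //; lia.
  apply: (bounded_mono (sub0set _)); have [sC' _ _ conC'] := cC'.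
  apply: IH => //; have := subset_leq_card sC'; rewrite [X in _ < X](cardsD1 x) xV.
  lia.
exists (x |: (D :|: D')).
  rewrite (cardsD1 x V) xV -(cardsID C (V :\ x)) (setIidPr sC).
  have h1 : #|x |: (D :|: D')| <= 1 + (#|D| + #|D'|).
    rewrite cardsU1; apply: leq_add; first by case: (_ \notin _).
    exact: leq_card_setU.
  have : #|x |: (D :|: D')| * k.+1 <= (1 + (#|D| + #|D'|)) * k.+1.
    by rewrite leq_mul2r h1 orbT.
  by rewrite !mulnDl mul1n; lia.
have := good_sepU _ gD gD'; set Q := (X in good X) => HQ.
apply: (@good_sub _ Q); last first.
  by apply: HQ; apply: sepS spCV; apply: subsetDl.
have N1 : N[[set x] :|: D] \subset N[x |: (D :|: D')].
  by apply: nbhdS; apply: setUS; apply: subsetUl.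
have N2 : N[[set x] :|: D'] \subset N[x |: (D :|: D')].
  by apply: nbhdS; apply: setUS; apply: subsetUr.
apply/subsetP=> z; rewrite set0U in_setD => /andP[zN zV].
rewrite /Q in_setU !in_setD in_set1 zV (contra (subsetP N1 z) zN).
rewrite (contra (subsetP N2 z) zN) /= andbT.
have -> : z != x; last by rewrite andbT orbN.
by apply: contraNneq zN => ->; apply: (@mem_nbhd _ x); rewrite ?inE ?eqxx.
Qed.

(** * A special component [H] of [V - N[v]] *)

Hypothesis nspV : ~ spec V.
Hypothesis ncut : forall x C, x \in V -> component C (V :\ x) -> ~ spec C.
Variable v : T.
Hypotheses (vV : v \in V) (vmax : forall w, w \in V -> #|nb V w| <= #|nb V v|).
Variable H : {set T}.
Hypotheses (cH : component H (V :\: N[[set v]])) (spH : spec H).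

Let sHV : H \subset V.
Proof. by have [sH _ _ _] := cH; apply: subset_trans sH (subsetDl _ _). Qed.

Let vH a : a \in H -> ~~ g v a.
Proof.
have [/subsetP sH _ _ _] := cH; move=> /sH; rewrite in_setD nbhd1 negb_or.
by case/andP=> /andP[].
Qed.

Let vNH : v \notin H.
Proof.
have [/subsetP sH _ _ _] := cH; apply/negP=> /sH.
by rewrite in_setD nbhd1 eqxx.
Qed.

(** A vertex [b] not adjacent to [v] would lie in [V - N[v]], hence in the component [H]; and [b] is
    not [v], which has no neighbour in [H]. *)
Let H_adj a b : a \in H -> b \in V -> b \notin H -> g a b -> g v b.
Proof.
move=> aH bV bH ab; apply: contraNT bH => vb.
apply: (component_closed cH aH _ ab); rewrite in_setD nbhd1 bV andbT.
rewrite negb_or vb andbT; apply: contraTneq ab => <-.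
by rewrite gS; apply: vH.
Qed.

(** If every edge leaving [H] ended in [z], then [H] would be a special component of [V :\ z], which
    [ncut] excludes. *)
Lemma link_avoiding z : z \in V ->
  exists x y, [/\ x \in V, x != z, g v x, y \in H & g x y].
Proof.
move=> zV; apply: contrapT => nex.
have lk a b : a \in H -> b \in V -> b \notin H -> g a b -> b = z.
  move=> aH bV bH ab; apply/eqP; apply: contrapT => /negP bz; apply: nex.
  by exists b, a; split=> //; [apply: H_adj ab | rewrite gS].
have [sH H0 _ conH] := cH.
have [zH|zH] := boolP (z \in H).
  have [|a [b [aH bH ab]]] := conV sHV H0.
    by apply: contraNneq vNH => ->.
  move: bH; rewrite inE => /andP[bH bV].
  by move: (bH); rewrite (lk _ _ aH bV bH ab) zH.
apply: (@ncut z H) => //; split=> //; first by rewrite subsetD1 sHV.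
move=> a b aH; rewrite !inE => /and3P[bH bz bV].
by apply: contraNN bz => ab; rewrite (lk a b).
Qed.

(** * A neighbour [x] linking [v] to [H], and the component [A] of [v] beside them *)

Section Linked.
Variables x y : T.
Hypotheses (xV : x \in V) (vx : g v x) (yH : y \in H) (xy : g x y).
Variable A : {set T}.
Hypotheses (cA : component A (V :\: (x |: H))) (vA : v \in A).

Let U := V :\: (x |: (H :|: A)).

Let sAV : A \subset V.
Proof. by have [sA _ _ _] := cA; apply: subset_trans sA (subsetDl _ _). Qed.

Let xA : x \notin A.
Proof.
have [/subsetP sA _ _ _] := cA; apply/negP=> /sA.
by rewrite !inE eqxx.
Qed.

Let xH : x \notin H.
Proof. by apply: contraTN vx => /vH. Qed.

Let AH a : a \in A -> a \notin H.
Proof.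
have [/subsetP sA _ _ _] := cA => /sA.
by rewrite !inE negb_or => /andP[/andP[]].
Qed.

Let v_adj z : z \in V -> g v z -> z != x -> z \in A.
Proof.
move=> zV vz zx; apply: (component_closed cA vA _ vz).
by rewrite !inE negb_or zx zV andbT /=; apply: contraTN vz => /vH.
Qed.

Let sep_AU : sep A U.
Proof.
have [_ _ sp _] := cA; apply: sepS sp => //; apply/subsetP=> z.
by rewrite !inE !negb_or; case: (z \in A); rewrite ?andbF ?andbT.
Qed.

(** By [H_adj], a neighbour of [H] outside [H] is a neighbour of [v], hence is [x] or lies in
    [A]. *)
Let sep_HU : sep H U.
Proof.
move=> a b aH; rewrite !inE !negb_or => /andP[/and3P[bx bH bA] bV].
by apply: contra bA => ab; apply: v_adj bx => //; apply: H_adj ab.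
Qed.

(** Since [U] has no edge to [H] or [A], its components are components of [V :\ x], and none of
    those is special. *)
Let bounded_U : bounded set0 U.
Proof.
apply: bounded_no_spec => [|C cC].
  apply: proper_card; apply/properP; split; first exact: subsetDl.
  by exists x; rewrite // !inE eqxx.
apply: (@ncut x) => //; apply: component_trans cC _ _.
  apply/subsetP=> z; rewrite !inE !negb_or.
  by move=> /andP[/and3P[-> _ _] ->].
move=> a b aU; rewrite !inE !negb_or => /and3P[+ bx bV].
rewrite bx bV andbT /= negb_and !negbK => /orP[bH|bA]; rewrite gS.
  exact: sep_HU.
exact: sep_AU.
Qed.

(** The cover of [H] through [y] also dominates [x] and is paid for by [x |: H]. What remains splits
    into [A], bounded by induction, and [U]. *)
Lemma bounded_no_spec_at : ~ spec A -> bounded set0 V.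
Proof.
move=> nspA; have [D [yD sD cD]] := spec_cover spH yH.
apply: (@bounded_cover (x |: H) _ D).
- by rewrite subUset sub1set xV.
- by rewrite cardsU1 xH.
- rewrite subUset sub1set sD andbT; apply: (mem_nbhd yD).
  by rewrite gS xy orbT.
have [sA _ sp conA] := cA.
have -> : V :\: (x |: H) = A :|: U.
  by rewrite -[LHS](setID _ A) (setIidPr sA) setDDl -setUA.
apply: bounded_sepU => //.
  by rewrite disjoints_subset; apply/subsetP=> a aA; rewrite !inE aA !orbT.
apply: IH => //; apply: proper_card; apply/properP; split=> //.
by exists x.
Qed.

Variables x' y' : T.
Hypotheses (x'V : x' \in V) (x'x : x' != x) (vx' : g v x').
Hypotheses (y'H : y' \in H) (xy' : g x' y').

Let x'A : x' \in A. Proof. exact: v_adj. Qed.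

(** Together [v] and [x'] dominate [x], [y'] and all of [A] but one vertex [d]. As [d] is not
    adjacent to [v], it has no neighbour in [H] by [H_adj]; since [y'] is dominated, [spec_kill]
    handles [H]. *)
Lemma bounded_c5_at : k = 2 -> is_c5 A -> bounded set0 V.
Proof.
move=> k2 c5A; have [b [c [d [e [h E]]]]] := is_c5_at c5A vA.
(* Orient the cycle so that [x'] follows [v]: being adjacent to [v], it is one of the two cycle
   neighbours. *)
have {b c d e h E} [c [d [e [h E]]]] : exists c d e,
    c5 v x' c d e /\ A =i [:: v; x'; c; d; e].
  move: (x'A); rewrite E !inE (negPf (_ : x' != v)) /=; last first.
    by rewrite eq_sym; apply: adj_neq.
  case/or4P=> /eqP x'E.
  - by exists c, d, e; rewrite x'E.
  - by case/and5P: h => _ _ _ _ /and5P[_ _ + _ _]; rewrite -x'E vx'.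
  - by case/and5P: h => _ _ _ _ /and5P[_ _ _ + _]; rewrite -x'E vx'.
  exists d, c, b; rewrite x'E; split; first exact: c5_rev h.
  move=> z; rewrite E !inE; case: (z == v); case: (z == b); case: (z == c);
    by case: (z == d); case: (z == e).
have cA5 := c5_card h E.
case/and5P: h => _ _ bc cd /and5P[de ea ac ad _].
have [D cD gD] := spec_kill spH y'H.
have dA : d \in A by rewrite E !inE eqxx !orbT.
have sep_dH : sep [set d] (H :\ y' :\: N[D]).
  move=> _ z /set1P-> /setDP[/setD1P[_ zH] _]; rewrite gS.
  apply: contra ad => zd; apply: H_adj zd => //; first exact: (subsetP sAV).
  exact: AH.
have sX : x |: (H :|: A) \subset V by rewrite !subUset sub1set xV sHV.
pose D' := [set v; x'] :|: D.
have memD' u w : u \in [set v; x'] -> (u == w) || g u w -> w \in N[D'].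
  by move=> uD; apply: mem_nbhd; rewrite in_setU uD.
have vD : v \in [set v; x'] by rewrite !inE eqxx.
have x'D : x' \in [set v; x'] by rewrite !inE eqxx orbT.
have sR : (x |: (H :|: A)) :\: N[D'] \subset [set d] :|: (H :\ y' :\: N[D]).
  apply/subsetP=> z /setDP[zX zN]; apply/setUP.
  have nzN u : u \in [set v; x'] -> (u == z) || g u z -> False.
    by move=> uD /(memD' _ _ uD); apply/negP.
  move: zX => /setU1P[zx|/setUP[zH|]].
  - by case: (nzN v vD); rewrite zx vx orbT.
  - right; rewrite in_setD in_setD1 zH andbT; apply/andP; split.
      exact: contra (subsetP (nbhdS (subsetUr _ _)) z) zN.
    by apply/eqP=> zy'; case: (nzN x' x'D); rewrite zy' xy' orbT.
  rewrite E !inE; case/or4P=> [|||/orP[]] /eqP zE.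
  - by case: (nzN v vD); rewrite zE eqxx.
  - by case: (nzN x' x'D); rewrite zE eqxx.
  - by case: (nzN x' x'D); rewrite zE bc orbT.
  - by left; rewrite zE eqxx.
  - by case: (nzN v vD); rewrite zE gS ea orbT.
apply: (bounded_extend sX _ _ _ bounded_U).
- have cX : #|x |: (H :|: A)| = 1 + (#|H| + 5).
    rewrite cardsU1 !inE negb_or xH xA cardsU cA5.
    suff -> : H :&: A = set0 by rewrite cards0 subn0.
    apply/setP=> z; rewrite !inE; apply/andP=> -[zH /AH].
    by rewrite zH.
  have cD' : #|D'| <= 2 + #|D|.
    apply: leq_trans (leq_card_setU _ _) _; rewrite leq_add2r cards2.
    by case: (_ != _).
  have ar p q r : q * 3 + 2 <= r -> p <= 2 + q -> p * 3 <= 1 + (r + 5).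
    by clear; lia.
  rewrite cX k2; apply: ar cD'.
  by rewrite k2 in cD.
- apply: good_sub sR _; apply: good_sepU => //.
  by apply: good_small; rewrite cards1 k2.
- move=> a b /setDP[/setU1P[ax|/setUP[aH|aA]] aN] bU.
  + by rewrite ax (memD' v) // ?vx ?orbT in aN.
  + exact: sep_HU.
  + exact: sep_AU.
Qed.

(** The neighbours of [v] lie in [x |: (A :\ v)], so by maximality all degrees are at most [k]. This
    determines the neighbourhoods of [x'] and [y']. Choosing [x'] works unless it leaves a special
    component, which must then be the clique on [x] and [H :\ y']. In that case choosing [x] works
    for [k >= 3], and [V] is a 5-cycle for [k = 2]. *)
Lemma bounded_clique_at : clique A -> #|A| = k -> bounded set0 V.
Proof.
move=> clA cardA.
have degk w : w \in V -> #|nb V w| <= k.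
  move=> wV; apply: leq_trans (vmax wV) _.
  apply: leq_trans (_ : #|x |: (A :\ v)| <= k).
    apply/subset_leq_card/subsetP=> z; rewrite !inE => /andP[zV vz].
    case: eqVneq => //= zx; rewrite v_adj // andbT eq_sym.
    exact: adj_neq.
  by rewrite cardsU1 -cardA (cardsD1 v A) vA leq_add2r; case: (_ \notin _).
have full w S : w \in V -> S \subset nb V w -> k <= #|S| -> nb V w = S.
  move=> wV sS cS; apply/esym/eqP; rewrite eqEcard sS.
  exact: leq_trans (degk _ wV) cS.
have hV z : z \in H -> z \in V by apply: (subsetP sHV).
have aV z : z \in A -> z \in V by apply: (subsetP sAV).
(* For [k = 2] no vertex has three neighbours, so no edge can leave a 5-cycle. *)
have three w a b c : k = 2 -> w \in V -> a \in V -> b \in V -> c \in V ->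
    uniq [:: a; b; c] -> g w a -> g w b -> g w c -> False.
  move=> k2 wV aV' bV cV uq wa wb wc.
  have : 3 <= #|nb V w|.
    have <- : #|[:: a; b; c]| = 3 by rewrite (card_uniqP uq).
    apply/subset_leq_card/subsetP=> z.
    by rewrite !inE => /or3P[] /eqP->; rewrite ?aV' ?bV ?cV ?wa ?wb ?wc.
  by have := degk _ wV; rewrite k2; case: #|_| => [|[|[|]]].
have [clH cardH] : clique H /\ #|H| = k.
  case: spH => [//|[k2 c5H]]; exfalso.
  have [b [c [d [e [h E]]]]] := is_c5_at c5H yH.
  have [bH eH] : b \in H /\ e \in H by rewrite !E !inE !eqxx !orbT.
  case/and5P: h => uq yb _ _ /and5P[_ ey _ _ _].
  apply: (three y x b e) => //; rewrite ?hV // 1?gS //.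
  rewrite /= !inE negb_or andbT -!andbA; apply/and3P; split.
  - by apply: contraNneq xH => ->.
  - by apply: contraNneq xH => ->.
  by move: uq; rewrite /= !inE !negb_or => /and5P[_ /and3P[]].
have nAH a h : a \in A -> h \in H -> a != h.
  by move=> /AH aH hH; apply: contraNneq aH => ->.
have nxH h : h \in H -> x != h by move=> hH; apply: contraNneq xH => ->.
have nxA a : a \in A -> x != a by move=> aA; apply: contraNneq xA => ->.
have y'A : y' \notin A by apply: contraL y'H; apply: AH.
have nbx' : nb V x' = y' |: (A :\ x').
  apply: full => //.
    apply/subsetP=> z; rewrite !inE => /orP[/eqP->|/andP[zx' zA]].
      by rewrite hV.
    by rewrite aV // clA // eq_sym.
  rewrite cardsU1 !inE negb_and y'A orbT -cardA (cardsD1 x' A) x'A.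
  exact: leqnn.
have nby' : nb V y' = x' |: (H :\ y').
  apply: full; first exact: hV.
    apply/subsetP=> z; rewrite !inE => /orP[/eqP->|/andP[zy' zH]].
      by rewrite x'V gS.
    by rewrite hV // clH // eq_sym.
  rewrite cardsU1 !inE negb_and (AH x'A) orbT -cardH (cardsD1 y' H) y'H.
  exact: leqnn.
have yy' : y != y'.
  apply/eqP=> yy'; have : x \in nb V y' by rewrite inE xV -yy' gS.
  by rewrite nby' !inE eq_sym (negPf x'x) (negPf xH) andbF.
(* This is [N[x']], whose [k + 1] vertices pay for [x']; only a special component outside it is an
   obstacle. *)
pose X2 := y' |: A.
have sX2 : X2 \subset V by rewrite subUset sub1set hV.
have cardX2 : #|X2| = k.+1 by rewrite cardsU1 y'A cardA.
have [[C [cC spC]]|nC] := EM (exists C, component C (V :\: X2) /\ spec C);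
  last first.
  apply: (@bounded_cover X2 _ [set x']) => //.
  - by rewrite cards1 mul1n cardX2.
  - apply/subsetP=> z; rewrite nbhd1 !inE => /orP[/eqP->|zA].
      by rewrite xy' orbT.
    by case: eqVneq => //= x'z; apply: clA.
  apply: bounded_no_spec => [|C cC spC]; last by apply: nC; exists C.
  apply: proper_card; apply/properP; split; first exact: subsetDl.
  by exists v; rewrite // !inE vA orbT.
have sC : C \subset V :\: X2 by case: cC.
have inX2 z : z \in V -> z != y' -> z \notin A -> z \in V :\: X2.
  by move=> zV zy' zA; rewrite !inE negb_or zV zy' zA.
have yC z : z \in H -> z != y' -> z \in V :\: X2.
  by move=> zH zy'; rewrite inX2 ?hV //; apply: contraL zH; apply: AH.
(* If [C] missed [x], it would miss [H] as well, so it would lie in [U] and be a component of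
   [V :\ x], against [ncut]. *)
have [xC|xC] := boolP (x \in C); last first.
  exfalso; apply: (@ncut x C) => //; have [_ C0 spC' conC] := cC.
  have yW := yC _ yH yy'.
  have yNC : y \notin C.
    apply: contraNN xC => yC'; apply: (component_closed cC yC'); last first.
      by rewrite gS.
    by apply: inX2 => //; apply: nxH.
  have HNC z : z \in H -> z \notin C.
    move=> zH; have [->//|zy] := eqVneq z y; apply: contraNN yNC => zC.
    by apply: (component_closed cC zC yW); apply: clH.
  have CU : C \subset U.
    apply/subsetP=> z zC; have /setDP[zV] := subsetP sC _ zC.
    rewrite !inE !negb_or => /andP[_ ->]; rewrite zV !andbT.
    by apply/andP; split; [apply: contraNneq xC => <- | apply/negP=> /HNC/negP].
  split=> //; first by rewrite subsetD1 xC (subset_trans sC) // subsetDl.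
  move=> a b aC; rewrite !inE => /and3P[bC bx bV].
  have aU := subsetP CU _ aC.
  have [bH|bH] := boolP (b \in H); first by rewrite gS; apply: sep_HU.
  have [bA|bA] := boolP (b \in A); first by rewrite gS; apply: sep_AU.
  apply: spC' => //; rewrite in_setD bC; apply: inX2 => //.
  by apply: contraNneq bH => ->.
have HC z : z \in H -> z != y' -> z \in C.
  move=> zH zy'; have yC' : y \in C.
    by apply: (component_closed cC xC) => //; apply: yC.
  have [->//|zy] := eqVneq z y.
  by apply: (component_closed cC yC'); [exact: yC | rewrite clH // eq_sym].
have vC : v \notin C.
  by apply/negP=> /(subsetP sC); rewrite !inE vA orbT.
have [clC cardC] : clique C /\ #|C| = k.
  case: spC => [//|[k2 c5C]]; exfalso.
  have [b [c [d [e [h E]]]]] := is_c5_at c5C xC.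
  have [bC eC] : b \in C /\ e \in C by rewrite !E !inE !eqxx !orbT.
  have CV z : z \in C -> z \in V by move=> /(subsetP sC) /setDP[].
  case/and5P: h => uq xb _ _ /and5P[_ ex _ _ _].
  apply: (three x v b e) => //; rewrite ?CV // 1?gS //.
  rewrite /= !inE negb_or andbT -!andbA; apply/and3P; split.
  - by apply: contraNneq vC => ->.
  - by apply: contraNneq vC => ->.
  by move: uq; rewrite /= !inE !negb_or => /and5P[_ /and3P[]].
have xH' z : z \in H -> z != y' -> g x z.
  by move=> zH zy'; apply: clC => //; [exact: HC | exact: nxH].
have k1 : k != 1.
  apply/eqP=> k1; have /card_le1P/(_ _ vA) /(_ x') : #|A| <= 1 by rewrite cardA k1.
  by rewrite x'A inE eq_sym (negPf (adj_neq vx')).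
have sX : x |: (H :|: A) \subset V by rewrite !subUset sub1set xV sHV.
have [k2|k2] := eqVneq k 2.
  (* The vertices [v, x, y, y', x'] form an induced 5-cycle on which all degrees are already 2, so
     by connectivity it is all of [V]. *)
  exfalso; apply: nspV; right; split=> //; exists v, x, y, y', x'.
  have xv := adj_neq vx; have xx' : x != x' by rewrite eq_sym.
  have vx'n := adj_neq vx'; have yV := hV _ yH; have y'V := hV _ y'H.
  have yx' : y != x' by rewrite eq_sym; apply: nAH.
  have y'x' : y' != x' by rewrite eq_sym; apply: nAH.
  have uq : uniq [:: v; x; y; y'; x'].
    rewrite /= !inE !negb_or xv xx' vx'n yx' y'x' yy'.
    by rewrite (nAH _ _ vA yH) (nAH _ _ vA y'H) (nxH _ yH) (nxH _ y'H).
  have yy'g : g y y' by apply: clH.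
  have y'x'g : g y' x' by rewrite gS.
  have x'v : g x' v by rewrite gS.
  split.
    have xy'g : g x y' = false.
      have: x \notin nb V y' by rewrite nby' !inE (negPf xx') (negPf xH) andbF.
      by rewrite inE xV gS => /negPf.
    have xx'g : g x x' = false.
      have: x \notin nb V x'.
        by rewrite nbx' !inE (negPf xA) andbF (negPf (nxH _ y'H)).
      by rewrite inE xV gS => /negPf.
    have yx'g : g y x' = false.
      have: y \notin nb V x'.
        rewrite nbx' !inE (negPf yy') /= negb_and orbC.
        by apply/orP; left; apply: contraL yH; apply: AH.
      by rewrite inE yV gS => /negPf.
    rewrite /c5 uq vx xy yy'g y'x'g x'v xy'g xx'g yx'g.
    by rewrite (negPf (vH yH)) (negPf (vH y'H)).
  pose S := [set z in [:: v; x; y; y'; x']].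
  have SV : S \subset V.
    by apply/subsetP=> z; rewrite !inE => /or4P[|||/orP[]] /eqP->.
  suff -> : V = S by move=> z; rewrite inE.
  apply/esym/eqP; apply: contrapT => /negP SnV.
  have [|a [b [aS /setDP[bV bS] ab]]] := conV SV _ SnV.
    by apply/set0Pn; exists v; rewrite !inE eqxx.
  have bn z : z \in S -> b != z by apply: contraTneq => <-.
  have dv : b != v by apply: bn; rewrite !inE eqxx.
  have dx : b != x by apply: bn; rewrite !inE eqxx orbT.
  have dy : b != y by apply: bn; rewrite !inE eqxx !orbT.
  have dy' : b != y' by apply: bn; rewrite !inE eqxx !orbT.
  have dx' : b != x' by apply: bn; rewrite !inE eqxx !orbT.
  move: aS ab; rewrite !inE => /or4P[|||/orP[]] /eqP-> ab.
  - apply: (three v b x x') => //.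
    by rewrite /= !inE !negb_or dx dx' xx'.
  - apply: (three x b v y) => //; last by rewrite gS.
    by rewrite /= !inE !negb_or dv dy (nAH _ _ vA yH).
  - apply: (three y b x y') => //; last by rewrite gS.
    by rewrite /= !inE !negb_or dx dy' (nxH _ y'H).
  - apply: (three y' b y x') => //; last by rewrite gS.
    by rewrite /= !inE !negb_or dy dx' yx'.
  - apply: (three x' b v y') => //.
    by rewrite /= !inE !negb_or dv dy' (nAH _ _ vA y'H).
(* Now [k >= 3], and [x] dominates [v] and all of [H] but [y']. Among the at most [k] vertices left,
   [y'] has no neighbour but [x'], and the other [k - 1] are too few for minimum degree [k - 1]. *)
apply: (@bounded_extend (x |: (H :|: A)) _ [set x] _ _ _ _ bounded_U) => //.
- rewrite cards1 mul1n cardsU1 !inE negb_or xH xA ltnS -cardH.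
  by apply/subset_leq_card/subsetUl.
- have sR : (x |: (H :|: A)) :\: N[[set x]] \subset y' |: (A :\ v).
    apply/subsetP=> z /setDP[zX]; rewrite nbhd1 negb_or eq_sym => /andP[zx xz].
    move: zX; rewrite 4!inE (negPf zx) /= => /orP[zH|zA]; rewrite !inE.
      by case: eqVneq => //= zy'; rewrite (xH' z) in xz.
    by rewrite zA andbT (contraNneq _ xz) ?orbT // => ->; rewrite gS.
  apply: good_sub sR _.
  have cR : #|y' |: A :\ v| = k.
    by rewrite cardsU1 !inE negb_and y'A orbT -cardA (cardsD1 v A) vA.
  split=> [w wR|S sS S0]; first by rewrite -[X in _ < X]cR; apply: nb_lt.
  have [y'S|y'S] := boolP (y' \in S).
    have k3 : 1 < k.-1 by move: k_gt0 k1 k2; clear; case: k => [|[|[|]]].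
    exists y' => //; apply: leq_ltn_trans k3.
    rewrite -(cards1 x'); apply/subset_leq_card/subsetP=> z.
    rewrite [_ \in nb _ _]inE => /andP[zS y'z].
    have : z \in nb V y'.
      rewrite inE y'z andbT; have := subsetP sS _ zS; rewrite !inE.
      by case/orP=> [/eqP->|/andP[_ /aV //]]; apply: hV.
    rewrite nby' !inE => /orP[//|/andP[zy' zH]].
    have := subsetP sS _ zS; rewrite !inE (negPf zy') /= => /andP[_ zA].
    by move: zH; rewrite (negPf (AH zA)).
  have [w wS] := set0Pn _ S0; exists w => //.
  apply: leq_trans (nb_lt wS) _.
  have -> : k.-1 = #|A :\ v| by rewrite -cardA (cardsD1 v A) vA.
  apply/subset_leq_card/subsetP=> z zS; have := subsetP sS _ zS.
  by rewrite inE => /orP[/set1P zy'|//]; rewrite -zy' zS in y'S.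
- move=> a b /setDP[/setU1P[ax|/setUP[aH|aA]] aN] bU.
  + by rewrite nbhd1 ax eqxx in aN.
  + exact: sep_HU.
  + exact: sep_AU.
Qed.

End Linked.

Lemma bounded_step : bounded set0 V.
Proof.
(* Avoiding [v] is automatic for a neighbour of [v]; the second call then asks for a link other than
   [x]. *)
have [x [y [xV xv vx yH xy]]] := link_avoiding vV.
have [x' [y' [x'V x'x vx' y'H xy']]] := link_avoiding xV.
have xH : x \notin H by apply: contraTN vx => /vH.
have [|A cA vA] := @component_of (V :\: (x |: H)) v.
  by rewrite !inE negb_or vNH vV eq_sym xv.
have [[[clA cardA]|[k2 c5A]]|nspA] := EM (spec A).
- exact: (bounded_clique_at xV vx yH xy cA vA x'V x'x vx' y'H xy').
- exact: (bounded_c5_at xV vx cA vA x'V x'x vx' y'H xy').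
exact: (bounded_no_spec_at xV vx yH xy cA vA).
Qed.

End InductionStep.

(** * The upper bound for connected non-special sets *)

Theorem bounded_connset V : connset V -> ~ spec V -> bounded set0 V.
Proof.
have [n] := ubnP #|V|; elim: n V => // n IHn V Vn conV nspV.
have IH W : #|W| < #|V| -> connset W -> ~ spec W -> bounded set0 W.
  by move=> WV; apply: IHn; apply: leq_trans WV _.
have set0D W : W :\: N[set0 :|: set0] = W.
  apply/setP=> z; rewrite in_setD; case: nbhdP => //= -[u].
  by rewrite !inE.
have [Vk|kV] := leqP #|V| k.
  exists set0; rewrite ?cards0 // set0D.
  have [?|nVk] := ltnP #|V| k; first exact: good_small.
  have Vk' : #|V| = k by apply/eqP; rewrite eqn_leq Vk.
  (* As [V] has [k] vertices and is not a clique, some [a] has at most [k - 2] neighbours, and the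
     empty set isolates. *)
  have [a [b [aV bV ab nab]]] :
      exists a b, [/\ a \in V, b \in V, a != b & ~~ g a b].
    apply: contrapT => nex; apply: nspV; left; split=> // a b aV bV ab.
    by apply: contrapT => /negP nab; apply: nex; exists a, b.
  split=> [w wV|S sS /set0Pn[s sS']].
    by rewrite -[X in _ < X]Vk'; apply: nb_lt.
  have [Sk|kS] := ltnP #|S| k.
    exists s => //; apply: leq_trans (nb_lt sS') _.
    by move: Sk; clear -k_gt0; case: k k_gt0.
  have SV : S = V by apply/eqP; rewrite eqEcard sS Vk'.
  exists a; rewrite SV // -Vk' (cardsD1 a V) aV /= (cardsD1 b (V :\ a)).
  rewrite !inE eq_sym ab bV ltnS.
  apply/subset_leq_card/subsetP=> z; rewrite !inE => /andP[-> az].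
  by rewrite andbT [z == a]eq_sym (adj_neq az) andbT; apply: contraNneq nab => <-.
have [v0 v0V] : exists v, v \in V by apply/card_gt0P; apply: leq_trans kV.
(* If all degrees are below [k], any single [v0] suffices: a nonempty set [S] avoiding it has a
   vertex with a neighbour outside [S], hence with at most [k - 2] neighbours inside. *)
have [[w wV wdeg]|small] := EM (exists2 w, w \in V & k <= #|nb V w|); last first.
  have deg w : w \in V -> #|nb V w| < k.
    by move=> wV; rewrite ltnNge; apply/negP=> h; apply: small; exists w.
  exists [set v0]; first by rewrite cards1 mul1n.
  split=> [w /setDP[wV _]|S sS S0].
    by apply: leq_ltn_trans (deg _ wV); apply: nbS; apply: subsetDl.
  have sSV := subset_trans sS (subsetDl _ _).
  apply: contrapT => nex.
  have [|a [b [aS /setDP[bV bS] ab]]] := conV S sSV S0.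
    apply: contraTneq v0V => <-; apply/negP=> /(subsetP sS) /setDP[_].
    by rewrite set0U nbhd1 eqxx.
  have aV := subsetP sSV _ aS.
  apply: nex; exists a => //; have := deg _ aV.
  suff : #|nb S a| < #|nb V a|.
    by case: (k) => //= m Sa Va; apply: leq_trans Sa Va.
  apply: proper_card; apply/properP; split.
    by apply/subsetP=> z; rewrite !inE => /andP[/(subsetP sSV)-> ->].
  by exists b; rewrite !inE ?bV // (negPf bS).
have [[x [C [xV cC spC]]]|ncut] :=
    EM (exists x C, [/\ x \in V, component C (V :\ x) & spec C]).
  exact: (bounded_cut IH conV xV cC).
pose v := [arg max_(u > w in V) #|nb V u|].
have [vV vmax] : v \in V /\ forall u, u \in V -> #|nb V u| <= #|nb V v|.
  by rewrite /v; case: arg_maxnP.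
have vdeg : k <= #|nb V v| by apply: leq_trans (vmax _ wV).
have [[H [cH spH]]|nH] := EM (exists H, component H (V :\: N[[set v]]) /\ spec H).
  apply: (bounded_step IH conV nspV _ vV vmax cH spH) => x C xV cC spC.
  by apply: ncut; exists x, C.
(* No special component remains, and the at least [k + 1] vertices of [N[v]] pay for [v]. *)
apply: (@bounded_cover (v |: nb V v) _ [set v]).
- by apply/subsetP=> z; rewrite !inE => /orP[/eqP->|/andP[]].
- by rewrite cards1 mul1n cardsU1 inE gI andbF.
- apply/subsetP=> z; rewrite nbhd1 !inE eq_sym.
  by case/orP=> [->//|/andP[_ ->]]; rewrite orbT.
have -> : V :\: (v |: nb V v) = V :\: N[[set v]].
  apply/setP=> z; rewrite !in_setD nbhd1 !inE [z == v]eq_sym.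
  by case: (z \in V); rewrite ?andbF ?andbT.
apply: (bounded_no_spec IH) => [|C cC spC]; last by apply: nH; exists C.
apply: proper_card; apply/properP; split; first exact: subsetDl.
by exists v; rewrite // in_setD nbhd1 eqxx.
Qed.

End Isolation.

(** * Translation to graph families, and the lower bound *)

Lemma iso_number_le (T : finType) (g : rel T) (F : graph_family) (D : {set T}) :
  isolating g F D -> iso_number g F <= #|D|.
Proof.
move=> /asboolT FD; rewrite /iso_number.
have: D \in index_enum {set T} by rewrite mem_index_enum.
elim: (index_enum _) => // C s IHs; rewrite inE big_cons => /orP[/eqP<-|Ds].
  by rewrite FD geq_minl.
by case: ifP => _; [apply: leq_trans (geq_minr _ _) _|]; apply: IHs.
Qed.

(** The hypothesis [q <= #|T|] takes care of the default value of the minimum. *)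
Lemma leq_iso_number (T : finType) (g : rel T) (F : graph_family) q :
  q <= #|T| -> (forall D : {set T}, isolating g F D -> q <= #|D|) ->
  q <= iso_number g F.
Proof.
move=> qT qD; apply: (big_ind (leq q)) => // [a b qa qb|D /asboolP /qD //].
by rewrite leq_min qa qb.
Qed.

(** The centre of an embedded star would have degree at least [k], and the image of an embedded
    regular graph would have minimum degree at least [k - 1]; [good] excludes both. *)
Lemma good_isolating (T : finType) (g : rel T) k (D : {set T}) :
  good g k (~: closed_nbhd g D) -> isolating g (Fk k) D.
Proof.
move=> [degR minR] m h Fh [f [fI fR fh]]; case: Fh => [[p [pb ph]]|[r [kr]]].
  have pI := bij_inj pb.
  have := degR _ (fR (p ord0)); rewrite ltnNge => /negP; apply.
  have kE : #|[set f (p (lift ord0 i)) | i : 'I_k]| = k.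
    by rewrite card_imset ?card_ord // => i j /fI /pI; apply: lift_inj.
  rewrite -[X in X <= _]kE; apply/subset_leq_card/subsetP=> _ /imsetP[i _ ->]; rewrite inE fR.
  by apply: fh; rewrite ph.
case=> m_gt0 _ _ rh.
have [||_ /imsetP[i _ ->]] := minR [set f i | i : 'I_m].
- by apply/subsetP=> _ /imsetP[i _ ->]; apply: fR.
- by apply/set0Pn; exists (f (Ordinal m_gt0)); apply: imset_f.
rewrite ltnNge => /negP; apply; apply: leq_trans kr _.
rewrite -(rh i) -(card_imset _ fI).
apply/subset_leq_card/subsetP=> _ /imsetP[j + ->]; rewrite !inE => hij.
by rewrite imset_f // fh.
Qed.

Lemma connect_connset (T : finType) (g : rel T) :
  symmetric g -> (forall x y, connect g x y) -> connset g [set: T].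
Proof.
move=> gS con S _ /set0Pn[a aS] SnT; apply: contrapT => nex.
have clS : closed g (mem S).
  apply: (intro_closed (sym_connect_sym gS)) => u w uw uS; apply: contrapT => /negP wS.
  by apply: nex; exists u, w; rewrite inE in_setT andbT.
case/eqP: SnT; apply/setP=> w; rewrite in_setT.
by have := closed_connect clS (con a w); rewrite aS => <-.
Qed.

Lemma spec_special n (g : rel 'I_n) k :
  symmetric g -> irreflexive g -> spec g k [set: 'I_n] -> special g k.
Proof.
move=> gS gI [[clT]|[-> [a [b [c [d [e [h E]]]]]]]].
  rewrite cardsT card_ord => nk; subst k; left; exists id; split.
    exact: (Bijective (g := id)).
  move=> x y; rewrite /complete_graph; have [->|xy] := eqVneq x y.
    by rewrite gI.
  by rewrite clT.
right; split=> //; exists (fun i : 'I_5 => nth a [:: a; b; c; d; e] i); split.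
  apply: inj_card_bij; last by rewrite -cardsT (c5_card h E) card_ord.
  move=> i j /eqP; case/and5P: h => uq _ _ _ _.
  by rewrite nth_uniq // => /eqP /val_inj.
case/and5P: h => _ ab bc cd /and5P[de ea ac ad /and3P[bd be ce]].
(* All 25 pairs of positions are checked; those listed in the opposite orientation are turned round
   by [gS]. *)
by case=> [[|[|[|[|[|i]]]]] //= iP] [[|[|[|[|[|j]]]]] //= jP];
  rewrite /cycle5 ?gI //= ?(ab, bc, cd, de, ea) //;
  do 1?[exact: negbTE]; rewrite gS //; apply: negbTE.
Qed.

(** Every full block needs its own vertex of [D]: its [k] vertices other than the linking one form a
    [K_k], a regular graph of degree [k - 1], and have no neighbour outside the block. *)
Lemma Bnk_isolating_ge n k (g : rel 'I_n) (D : {set 'I_n}) :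
  0 < k -> isomorphic (Bnk n k) g -> isolating g (Fk k) D -> n %/ k.+1 <= #|D|.
Proof.
move=> k_gt0 [f [fb fE]] iD; have fI := bij_inj fb; have [f' ff' f'f] := fb.
suff block j : j < n %/ k.+1 -> exists2 u, u \in D & f' u %/ k.+1 = j.
  pose B := [seq f' u %/ k.+1 | u in D].
  have -> : #|D| = size B by rewrite size_image.
  rewrite -[X in X <= _](size_iota 0); apply: uniq_leq_size (iota_uniq _ _) _.
  move=> j; rewrite mem_iota => /block[u uD <-].
  exact: image_f.
move=> jn; apply: contrapT => nex.
(* The offset [i.+1] skips the linking vertex, which has offset 0 in its block. *)
have lt_n (i : 'I_k) : j * k.+1 + i.+1 < n.
  apply: leq_trans (_ : j.+1 * k.+1 <= n).
    by rewrite mulSn addnC ltn_add2r ltnS.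
  by apply: leq_trans (leq_divM n k.+1); rewrite leq_mul2r jn orbT.
pose w i : 'I_n := Ordinal (lt_n i).
have wdiv i : w i %/ k.+1 = j by rewrite /= divnMDl // divn_small ?addn0 // ltnS.
have wmod i : w i %% k.+1 = i.+1 by rewrite /= modnMDl modn_small // ltnS.
apply: (iD k (@complete_graph k)).
  right; exists k.-1; split=> //; split=> //.
  - by move=> x y; rewrite /complete_graph eq_sym.
  - by move=> x; rewrite /complete_graph eqxx.
  move=> x; rewrite -[in RHS](card_ord k) -(cardC1 x).
  by apply: eq_card => y; rewrite !inE /complete_graph eq_sym.
have wI : injective w by move=> x y [] /addnI [] /val_inj.
exists (fun i => f (w i)); split.
- by move=> x y /fI /wI.
- move=> x; rewrite inE; apply/negP=> /nbhdP[u uD].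
  rewrite -[u]f'f fE (inj_eq fI) => uw; apply: nex; exists u => //.
  rewrite -(wdiv x); case/orP: uw => [/eqP->//|/orP[/andP[/eqP-> _]//|]].
  by rewrite wmod /= andbF.
move=> x y xy; rewrite fE /Bnk !wdiv eqxx (inj_eq wI) andTb.
by rewrite [_ != _]xy.
Qed.

Theorem theorem4 (k n : nat) (g : rel 'I_n) :
  1 <= k -> symmetric g -> irreflexive g ->
  (forall x y, connect g x y) ->
  ~ special g k ->
  iso_number g (Fk k) <= n %/ k.+1 /\
  (isomorphic (Bnk n k) g -> iso_number g (Fk k) = n %/ k.+1).
Proof.
move=> k_gt0 gS gI con nsp.
have [|D cD gD] := bounded_connset gS gI k_gt0 (connect_connset gS con).
  by move=> /(spec_special gS gI).
have upper : iso_number g (Fk k) <= n %/ k.+1.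
  rewrite leq_divRL // -[X in _ <= X]card_ord -cardsT.
  apply: leq_trans _ cD; rewrite leq_mul2r iso_number_le ?orbT //.
  by apply: good_isolating; rewrite -setTD -(set0U D).
split=> // isoB; apply/eqP; rewrite eqn_leq upper.
apply: leq_iso_number; first by rewrite card_ord leq_div.
by move=> E; apply: Bnk_isolating_ge.
Qed.
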